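(* Let $k\in\mathbb{N}$, $r\in\mathbb{N}_0$, let $\mathsf f=\{f_1,\dots,f_k\}$ and $\mathsf g=\{g_0=1,g_1,\dots,g_r\}$ be subsets of $\mathbb{R}[x_1,\dots,x_d]$, and suppose that the semiring $S(\mathsf f)$ generated by $f_1,\dots,f_k$ is Archimedean. Let $C(\mathsf f,\mathsf g)=g_0S(\mathsf f)+g_1S(\mathsf f)+\cdots+g_rS(\mathsf f)$. (i) If $h\in\mathbb{R}[x_1,\dots,x_d]$ satisfies $h(x)>0$ for all $x\in\mathcal{K}(\mathsf f)\cap\mathcal{K}(\mathsf g)$, then $h\in C(\mathsf f,\mathsf g)$. (ii) Suppose $L$ is a linear functional on $\mathbb{R}[x_1,\dots,x_d]$ such that $L(f)\ge0$ for all $f\in C(\mathsf f,\mathsf g)$. Then $L$ is a $\mathcal{K}(\mathsf f)\cap\mathcal{K}(\mathsf g)$-moment functional, that is, there is a (positive) Radon measure $\mu$ on $\mathbb{R}^d$ supported on the compact semi-algebraic set $\mathcal{K}(\mathsf f)\cap\mathcal{K}(\mathsf g)$ such that $L(f)=\int f(x)\,d\mu(x)$ for all $f\in\mathbb{R}[x_1,\dots,x_d]$.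
   Context: For a finite set $\mathsf p=\{p_1,\dots,p_m\}$ of polynomials, $\mathcal{K}(\mathsf p)=\{x\in\mathbb{R}^d: p_1(x)\ge0,\dots,p_m(x)\ge0\}$. The semiring generated by $f_1,\dots,f_k$ is the set $S(\mathsf f)$ of all finite sums of terms $\alpha f_1^{n_1}\cdots f_k^{n_k}$ with real $\alpha\ge0$ and $n_1,\dots,n_k\in\mathbb{N}_0$. It is Archimedean if for every $a\in\mathbb{R}[x_1,\dots,x_d]$ there exists $\lambda>0$ with $\lambda-a\in S(\mathsf f)$. *)

(* Defs.v *)
From mathcomp Require Import all_boot all_order all_algebra.
(* The notations of mpoly clash with those of MathComp-Analysis. *)
From mathcomp Require mpoly.
Import (canonicals, coercions) mpoly.
From mathcomp Require Import all_classical all_reals all_analysis.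

Set Implicit Arguments.
Unset Strict Implicit.
Unset Printing Implicit Defensive.

Import Order.TTheory GRing.Theory Num.Theory.
Import numFieldNormedType.Exports.

Local Open Scope classical_set_scope.
Local Open Scope ring_scope.

Notation "{ 'mpoly' R [ d ] }" := (mpoly.mpoly d R) : type_scope.

Definition evalp (R : realType) (d : nat) (p : {mpoly R[d]}) (x : 'rV[R]_d) : R :=
  mpoly.meval (fun i => x ord0 i) p.

Definition nonneg_set (R : realType) (d m : nat) (p : 'I_m -> {mpoly R[d]}) :
    set 'rV[R]_d :=
  [set x | forall i, 0 <= evalp (p i) x].

Definition gen_semiring (R : realType) (d k : nat) (f : 'I_k -> {mpoly R[d]}) :
    set {mpoly R[d]} :=
  [set p | exists n (a : 'I_n -> R) (e : 'I_n -> 'I_k -> nat),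
    (forall j, 0 <= a j) /\
    p = \sum_(j < n) a j *: \prod_(i < k) f i ^+ e j i].

Definition archimedean_semiring (R : realType) (d : nat)
    (S : set {mpoly R[d]}) : Prop :=
  forall a : {mpoly R[d]},
    exists2 lambda : R, 0 < lambda & S (mpoly.mpolyC d lambda - a).

(* g_0 S(f) + g_1 S(f) + ...; g_0 = 1 is not built in, it must be assumed of g. *)
Definition semiring_cone (R : realType) (d k m : nat)
    (f : 'I_k -> {mpoly R[d]}) (g : 'I_m -> {mpoly R[d]}) :
    set {mpoly R[d]} :=
  [set p | exists s : 'I_m -> {mpoly R[d]},
    (forall j, gen_semiring f (s j)) /\ p = \sum_(j < m) g j * s j].

Definition borel_rV (R : realType) (d : nat) :=
  g_sigma_algebraType (@open 'rV[R]_d).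

Definition radon_measure (R : realType) (d : nat)
    (mu : {measure set (borel_rV R d) -> \bar R}) : Prop :=
  (forall A : set 'rV[R]_d, compact A -> (mu A < +oo)%E) /\
  (forall B : set (borel_rV R d), measurable B ->
     mu B = ereal_sup [set mu A | A in
                         [set A : set 'rV[R]_d | compact A /\ A `<=` B]]).

Definition moment_functional (R : realType) (d : nat) (K : set 'rV[R]_d)
    (L : {mpoly R[d]} -> R) : Prop :=
  exists mu : {measure set (borel_rV R d) -> \bar R},
    [/\ radon_measure mu,
        mu (~` K) = 0%E
      & forall p : {mpoly R[d]},
          mu.-integrable setT (fun x => (evalp p x)%:E) /\
          (L p)%:E = \int[mu]_x (evalp p x)%:E]%E.

(* Main.v *)
Require Import Defs.
From mathcomp Require Import all_boot all_order all_algebra.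
From mathcomp Require mpoly.
Import (canonicals, coercions) mpoly.
From mathcomp Require Import all_classical all_reals all_analysis.
From mathcomp Require Import measurable_realfun.
From mathcomp Require Import ring lra zify.

Set Implicit Arguments.
Unset Strict Implicit.
Unset Printing Implicit Defensive.

Import Order.TTheory GRing.Theory Num.Theory.
Import numFieldNormedType.Exports.

Local Open Scope classical_set_scope.
Local Open Scope ring_scope.

(** The representation theorem rests on one maximality argument.  In an ordered
    vector space with a distinguished vector [e], take a cone that omits [-e] and
    is stable under a commutative cone of linear operators, and enlarge it to a
    maximal such cone [P] ([maximal_op_module]).  Maximality forces [P] or [-P] to
    contain every vector dominated by [e] ([maximal_op_module_total]), so that each
    such vector is a cut of the real line; the cut value is a linear functional
    which is moreover multiplicative for the operators
    ([exists_multiplicative_state]).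

    (i) For polynomials, with multiplications by the elements of the semiring as
    operators, the functional is a ring morphism to the reals because every
    polynomial is a semiring element minus a constant; hence it is the evaluation
    at a point where the cone is nonnegative ([proper_smodule_has_point]).
    Where [C] is nonnegative [h] is positive, so no such point exists for the cone
    [C - S h], which must therefore contain [-1]: [s h - 1] lies in [C] for some
    [s] in the semiring.  From there the constant that has to be added to [h] to
    reach the cone is lowered, by a fixed amount at a time, until none is left
    ([positivstellensatz_smodule]).

    (ii) By (i), [L] is nonnegative on polynomials that are nonnegative on the
    compact set [K].  The same maximality argument, now with the nonnegative
    scalars as operators, extends [L] to a positive functional on all functions
    bounded on [K] ([positive_extension]), that is to a finitely additive
    measure defined on every subset.  Countable additivity is recovered by
    transporting Lebesgue measure.  A sequence of yes/no questions cuts [K] into smaller and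
    smaller cells, numbered so that the cells of one depth refine those of the
    previous one in order.  The masses of the cells cut the interval
    [0, Lambda 1) into slots of the same lengths, nested in the same way.  Sending
    a real number to a point adherent to all the cells whose slots contain it
    defines a map [X] ([quantile_exists]), and the image of Lebesgue measure under
    [X] integrates every continuous function to its value under the functional,
    since both sides are within any given error of the same finite sum over cells
    ([riesz_approx]).  Inner regularity is inherited from Lebesgue measure because
    [X] is continuous off the countably many end points of slots
    ([riesz_measure_regular]). *)


(** * Maximal modules of operators and their states *)

Section states.
Variables (R : realType) (V : lmodType R) (e : V) (S : set (V -> V)).

(** Operators rather than elements of a ring, so that the same argument applies to
    polynomials with multiplications and to functions with nonnegative scalars. *)
Record commuting_cone_of_operators : Prop := CommutingCone {
  ops_linear : forall s, S s -> forall a u v, s (a *: u + v) = a *: s u + s v;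
  ops_comm : forall s t, S s -> S t -> forall v, s (t v) = t (s v);
  ops_add : forall s t, S s -> S t -> S (fun v => s v + t v);
  ops_comp : forall s t, S s -> S t -> S (fun v => s (t v));
  ops_scale : forall r, 0 <= r -> S (fun v => r *: v) }.

Definition op_module (P : set V) :=
  (forall u v, P u -> P v -> P (u + v)) /\
  (forall s, S s -> forall v, P v -> P (s v)).

(** Domination by a multiple of [e] for the order whose positive cone is [P]. *)
Definition bounded_by (P : set V) (v : V) :=
  exists l, P (l *: e - v) /\ P (l *: e + v).

Hypothesis HS : commuting_cone_of_operators.

Lemma ops0 s : S s -> s 0 = 0.
Proof.
move=> Ss; have := ops_linear HS Ss (-1) 0 0.
by rewrite !scaleN1r oppr0 addr0 addNr.
Qed.

Lemma opsD s : S s -> forall u v, s (u + v) = s u + s v.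
Proof. by move=> Ss u v; have := ops_linear HS Ss 1 u v; rewrite !scale1r. Qed.

Lemma opsZ s : S s -> forall a v, s (a *: v) = a *: s v.
Proof. by move=> Ss a v; have := ops_linear HS Ss a v 0; rewrite (ops0 Ss) !addr0. Qed.

Lemma opsN s : S s -> forall v, s (- v) = - s v.
Proof. by move=> Ss v; rewrite -scaleN1r (opsZ Ss) scaleN1r. Qed.

Lemma op_moduleZ P : op_module P -> forall r, 0 <= r -> forall v, P v -> P (r *: v).
Proof. by move=> [_ PS] r r0 v Pv; exact: (PS _ (ops_scale HS r0)). Qed.

Lemma op_moduleN P : op_module P -> P e ->
  forall r, r < 0 -> P (r *: e) -> P (- e).
Proof.
move=> PM Pe r r0 /(op_moduleZ PM (_ : 0 <= - r^-1)).
rewrite scalerA mulNr mulVf ?lt_eqF// scaleN1r; apply.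
by rewrite oppr_ge0 invr_le0 ltW.
Qed.

(** Zorn's lemma, over the empty set and the modules above [P0]: the empty set
    is admitted because the union of the empty chain is empty. *)
Lemma maximal_op_module (P0 : set V) : op_module P0 -> P0 e -> ~ P0 (- e) ->
  exists P, [/\ op_module P, P0 `<=` P, ~ P (- e) &
    forall Q, op_module Q -> P `<=` Q -> ~ Q (- e) -> Q `<=` P].
Proof.
move=> PM0 P0e nP0.
have [|P [[[PM nPe]] P0P]] := @Zorn_bigcup V
  [set P | (op_module P /\ ~ P (- e)) /\ (P0 `<=` P \/ P = set0)].
  move=> F FP Ftot; split; first split.
  - split.
      move=> u v [A FA Au] [B FB Bv].
      have [AB|BA] := Ftot _ _ FA FB.
        by exists B => //; apply (FP _ FB).1.1.1 => //; exact: AB.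
      by exists A => //; apply (FP _ FA).1.1.1 => //; exact: BA.
    move=> s Ss v [A FA Av]; exists A => //.
    exact: ((FP _ FA).1.1.2 _ Ss).
  - by move=> [A FA]; exact: (FP _ FA).1.2.
  - have [[A [FA [x Ax]]]|nF] := pselect (exists A, F A /\ A !=set0).
      left; apply: (@subset_trans _ A); last exact: bigcup_sup.
      by have [//|A0] := (FP _ FA).2; rewrite A0 in Ax.
    right; rewrite -subset0 => x [A FA Ax]; apply: nF.
    by exists A; split => //; exists x.
move=> Pmax; exists P; split => //.
- case: P0P => // PE; exfalso; apply: (Pmax P0).
    by rewrite PE; split=> [? []//|]; move=> /(_ _ P0e).
  by split; [split|left].
- move=> Q QM PQ nQe; apply: contrapT => nQP; apply: (Pmax Q) => //.
  split; first by [].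
  left; case: P0P => [P0P|PE]; first exact: subset_trans PQ.
  exfalso; apply: (Pmax P0).
    by rewrite PE; split=> [? []//|]; move=> /(_ _ P0e).
  by split; [split|left].
Qed.

(** If both [P + S a] and [P - S a] contained [-e], say
    [-e = q1 + s1 a = q2 - s2 a], eliminating [a] between the two equations with
    the help of commutativity would give [- s1 e] in [P].  As [a] exceeds some
    multiple of [e], [s1 a] would then lie in [P], and so would [-e]. *)
Lemma maximal_op_module_total P : op_module P -> P e -> ~ P (- e) ->
    (forall Q, op_module Q -> P `<=` Q -> ~ Q (- e) -> Q `<=` P) ->
  forall a, bounded_by P a -> P a \/ P (- a).
Proof.
move=> PM Pe nPe Pmax.
have P0 : P 0 by rewrite -(scale0r e); apply: op_moduleZ.
have adjoin a : ~ P a -> exists q s, [/\ P q, S s & - e = q + s a].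
  move=> nPa; apply: contrapT => nq.
  (* otherwise the module generated by [P] and [a] still omits [-e] *)
  apply: nPa; apply: (Pmax [set v | exists q s, [/\ P q, S s & v = q + s a]]).
  - split.
      move=> _ _ [q [s [Pq Ss ->]]] [q' [s' [Pq' Ss' ->]]].
      exists (q + q'), (fun v => s v + s' v); split; last by rewrite addrACA.
        exact: PM.1.
      exact: (ops_add HS).
    move=> t St _ [q [s [Pq Ss ->]]].
    exists (t q), (fun v => t (s v)); split; last by rewrite opsD.
      exact: PM.2.
    exact: (ops_comp HS).
  - move=> v Pv; exists v, (fun v => 0 *: v); split => //.
      exact: (ops_scale HS).
    by rewrite scale0r addr0.
  - by move=> [q [s H]]; apply: nq; exists q, s.
  - exists 0, (fun v => 1 *: v); split => //.
      exact: (ops_scale HS).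
    by rewrite add0r scale1r.
move=> a [l [_ Pla]]; have [|nPa] := pselect (P a); first by left.
right; apply: contrapT => /adjoin[q2 [s2 [Pq2 Ss2 E2]]].
have [q1 [s1 [Pq1 Ss1 E1]]] := adjoin _ nPa.
have Ns1e : P (- s1 e).
  have -> : - s1 e = s2 q1 + s1 q2 + s2 e.
    have F1 : - s2 e = s2 q1 + s2 (s1 a) by rewrite -opsN// E1 opsD.
    have F2 : - s1 e = s1 q2 - s2 (s1 a).
      by rewrite -(opsN Ss1) E2 (opsD Ss1) (opsN Ss2) (opsN Ss1) (ops_comm HS Ss1 Ss2).
    by rewrite F2 -[s2 e]opprK F1 opprD [s2 q1 + s1 q2]addrC addrA addrK.
  by apply: PM.1; [apply: PM.1|]; apply: PM.2.
apply: nPe; rewrite E1; apply: (PM.1 _ _ Pq1).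
have [l0|l0] := leP l 0; last first.
  have -> : s1 a = s1 (l *: e + a) + l *: (- s1 e).
    by rewrite opsD// opsZ// scalerN addrAC subrr add0r.
  apply: PM.1; first exact: PM.2.
  by apply: (op_moduleZ PM) => //; exact: ltW.
have -> : s1 a = s1 (l *: e + a) + (- l) *: s1 e.
  by rewrite opsD// opsZ// scaleNr addrAC subrr add0r.
apply: PM.1; first exact: PM.2.
apply: (op_moduleZ PM); first by rewrite oppr_ge0.
exact: PM.2.
Qed.

(** A linear functional that is a ring morphism as far as the operators can
    tell.  It sends [v] to the supremum of the [r] with [v - r e] in a maximal
    module; by totality [r e - v] belongs to that module as soon as [r] exceeds the
    supremum, and every identity below is obtained by comparing these two cuts. *)
Theorem exists_multiplicative_state (P0 : set V) :
    op_module P0 -> P0 e -> ~ P0 (- e) ->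
  exists phi : V -> R,
    [/\ phi e = 1,
        forall v, bounded_by P0 v -> P0 v -> 0 <= phi v,
        forall a u v, bounded_by P0 u -> bounded_by P0 v ->
          phi (a *: u + v) = a * phi u + phi v &
        forall s v, S s -> bounded_by P0 (s e) -> bounded_by P0 v ->
          bounded_by P0 (s v) -> phi (s v) = phi (s e) * phi v].
Proof.
move=> PM0 P0e nP0e.
have [P [PM P0P nPe Pmax]] := maximal_op_module PM0 P0e nP0e.
have Pe := P0P _ P0e.
have Ptot := maximal_op_module_total PM Pe nPe Pmax.
have bP v : bounded_by P0 v -> bounded_by P v.
  by move=> [l [/P0P ? /P0P ?]]; exists l.
have bZ v r : bounded_by P v -> bounded_by P (v - r *: e).
  move=> [l [Pl1 Pl2]]; exists (l + `|r|); split.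
    rewrite (_ : _ - _ = (l *: e - v) + (`|r| + r) *: e); last first.
      by rewrite !scalerDl opprB [r *: e - v]addrC addrACA.
    apply: PM.1 => //; apply: (op_moduleZ PM) => //.
    by rewrite -lerBlDr sub0r -normrN ler_norm.
  rewrite (_ : _ + _ = (l *: e + v) + (`|r| - r) *: e); last first.
    by rewrite !scalerDl scaleNr addrACA.
  apply: PM.1 => //; apply: (op_moduleZ PM) => //.
  by rewrite subr_ge0 ler_norm.
have lt_of v r r' : P (v - r *: e) -> P (r' *: e - v) -> r <= r'.
  move=> H1 H2; rewrite leNgt; apply/negP => rr'.
  apply: nPe; apply: (@op_moduleN P PM Pe (r' - r)); first by rewrite subr_lt0.
  by have := PM.1 _ _ H2 H1; rewrite addrA subrK scalerBl.
pose phi v := sup [set r | P (v - r *: e)].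
have hs v : bounded_by P v -> has_sup [set r | P (v - r *: e)].
  move=> [l [Pl1 Pl2]]; split.
    by exists (- l); rewrite /= scaleNr opprK addrC.
  by exists l => r /= Pr; exact: (lt_of v).
have lo v r : bounded_by P v -> r < phi v -> P (v - r *: e).
  rewrite -subr_gt0 => bv /sup_adherent/(_ (hs _ bv))[r' /= Pr'].
  rewrite -/(phi v) opprB addrC subrK => rr'.
  rewrite (_ : _ - _ = (v - r' *: e) + (r' - r) *: e).
    by apply: PM.1 => //; apply: (op_moduleZ PM) => //; rewrite subr_ge0 ltW.
  by rewrite scalerBl addrA subrK.
have up v r : bounded_by P v -> phi v < r -> P (r *: e - v).
  move=> bv rv; have [|] := Ptot (v - r *: e) (bZ _ _ bv); last by rewrite opprB.
  move=> Pr; have : r <= phi v by apply: (ub_le_sup (hs _ bv).2).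
  by rewrite leNgt rv.
have glo v r : bounded_by P v -> P (v - r *: e) -> r <= phi v.
  by move=> bv Pr; apply: (ub_le_sup (hs _ bv).2).
have gup v r : bounded_by P v -> P (r *: e - v) -> phi v <= r.
  by move=> bv Pr; apply: (ge_sup (hs _ bv).1) => r' /= Pr'; exact: (lt_of v).
have eqcut v x : bounded_by P v -> (forall r, r < x -> P (v - r *: e)) ->
    (forall r, x < r -> P (r *: e - v)) -> phi v = x.
  move=> bv H1 H2; apply/eqP; rewrite eq_le; apply/andP; split.
    by apply/ler_addgt0Pr => d d0; apply: gup => //; apply: H2; rewrite ltrDl.
  apply/ler_addgt0Pl => d d0; rewrite -lerBlDl.
  by apply: glo => //; apply: H1; rewrite gtrBl.
have be : bounded_by P e.
  exists 1; rewrite scale1r subrr; split; last exact: PM.1.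
  by rewrite -(scale0r e); apply: (op_moduleZ PM).
have phie : phi e = 1.
  apply: eqcut => // r r1; last first.
    rewrite -[X in _ - X]scale1r -scalerBl.
    by apply: (op_moduleZ PM) => //; rewrite subr_ge0 ltW.
  rewrite -[X in X - _]scale1r -scalerBl.
  by apply: (op_moduleZ PM) => //; rewrite subr_ge0 ltW.
have bD u v : bounded_by P u -> bounded_by P v -> bounded_by P (u + v).
  move=> [l [l1 l2]] [m [m1 m2]]; exists (l + m); rewrite scalerDl; split.
    by rewrite opprD addrACA; apply: PM.1.
  by rewrite addrACA; apply: PM.1.
have bN u : bounded_by P u -> bounded_by P (- u).
  by move=> [l [l1 l2]]; exists l; rewrite opprK.
have phiD u v : bounded_by P u -> bounded_by P v -> phi (u + v) = phi u + phi v.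
  move=> bu bv; apply: eqcut; first exact: bD.
    move=> r rx; pose d := (phi u + phi v - r) / 2.
    have d0 : 0 < d by rewrite divr_gt0// subr_gt0.
    rewrite (_ : r = (phi u - d) + (phi v - d)); last by rewrite /d; field.
    by rewrite scalerDl opprD addrACA; apply: PM.1; apply: lo => //; rewrite gtrBl.
  move=> r rx; pose d := (r - (phi u + phi v)) / 2.
  have d0 : 0 < d by rewrite divr_gt0// subr_gt0.
  rewrite (_ : r = (phi u + d) + (phi v + d)); last by rewrite /d; field.
  by rewrite scalerDl opprD addrACA; apply: PM.1; apply: up => //; rewrite ltrDl.
have phiZ a u : 0 < a -> bounded_by P u ->
    bounded_by P (a *: u) /\ phi (a *: u) = a * phi u.
  move=> a0 bu.
  have bau : bounded_by P (a *: u).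
    have [l [l1 l2]] := bu; exists (a * l); rewrite -scalerA -scalerBr -scalerDr.
    by split; apply: (op_moduleZ PM) => //; exact: ltW.
  split=> //; apply: eqcut => // r rx.
    rewrite (_ : r = a * (r / a)); last by field; rewrite gt_eqF.
    rewrite -scalerA -scalerBr; apply: (op_moduleZ PM); first exact: ltW.
    by apply: lo => //; rewrite ltr_pdivrMr// mulrC.
  rewrite (_ : r = a * (r / a)); last by field; rewrite gt_eqF.
  rewrite -scalerA -scalerBr; apply: (op_moduleZ PM); first exact: ltW.
  by apply: up => //; rewrite ltr_pdivlMr// mulrC.
have P0' : P 0 by rewrite -(scale0r e); apply: (op_moduleZ PM).
have b0 : bounded_by P 0 by exists 0; rewrite scale0r subr0 addr0.
have phi0 : phi 0 = 0 by have := phiD _ _ b0 b0; rewrite addr0; lra.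
have phiN u : bounded_by P u -> phi (- u) = - phi u.
  by move=> bu; have := phiD _ _ bu (bN _ bu); rewrite subrr phi0; lra.
have phiL a u : bounded_by P u -> bounded_by P (a *: u) /\ phi (a *: u) = a * phi u.
  move=> bu; have [a0|a0|->] := ltgtP a 0; last by rewrite scale0r mul0r phi0.
    have na0 : 0 < - a by rewrite oppr_gt0.
    have [b1 E1] := phiZ (- a) (- u) na0 (bN _ bu).
    by move: b1 E1; rewrite scaleNr scalerN opprK phiN// mulrNN.
  exact: phiZ.
have phige0 v : bounded_by P v -> P v -> 0 <= phi v.
  by move=> bv Pv; apply: glo => //; rewrite scale0r subr0.
exists phi; split => //.
- by move=> v /bP bv /P0P; exact: phige0.
- move=> a u v /bP bu /bP bv; have [bau <-] := phiL a _ bu.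
  by rewrite phiD.
- move=> s v Ss /bP bse /bP bv /bP bsv.
  have se0 : 0 <= phi (s e) by apply: phige0 => //; exact: PM.2.
  (* [s (v - r e)] lies in [P] for [r < phi v], so [phi (s v)] is at least
     [r * phi (s e)]; symmetrically from above *)
  apply/eqP; rewrite eq_le; apply/andP; split.
    apply/ler_addgt0Pr => d d0; pose c := d / (phi (s e) + 1).
    have c0 : 0 < c by rewrite divr_gt0// ltr_wpDl.
    have Pc : P (s ((phi v + c) *: e - v)).
      by apply: PM.2 => //; apply: up => //; rewrite ltrDl.
    have : 0 <= phi (s ((phi v + c) *: e - v)).
      apply: phige0 => //; rewrite (opsD Ss) (opsZ Ss) (opsN Ss).
      by apply: bD; [exact: (phiL _ _ bse).1|exact: bN].
    rewrite (opsD Ss) (opsZ Ss) (opsN Ss) phiD; [|exact: (phiL _ _ bse).1|exact: bN].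
    rewrite (phiL _ _ bse).2 phiN// subr_ge0 => /le_trans; apply.
    rewrite mulrDl mulrC lerD2l /c mulrAC ler_pdivrMr ?ltr_wpDl//.
    by rewrite ler_wpM2l// ?ltW// ltrDl.
  apply/ler_addgt0Pr => d d0; pose c := d / (phi (s e) + 1).
  have c0 : 0 < c by rewrite divr_gt0// ltr_wpDl.
  have Pc : P (s (v - (phi v - c) *: e)).
    by apply: PM.2 => //; apply: lo => //; rewrite gtrBl.
  have : 0 <= phi (s (v - (phi v - c) *: e)).
    apply: phige0 => //; rewrite (opsD Ss) (opsN Ss) (opsZ Ss).
    by apply: bD => //; apply: bN; exact: (phiL _ _ bse).1.
  rewrite (opsD Ss) (opsN Ss) (opsZ Ss) phiD//; last first.
    by apply: bN; exact: (phiL _ _ bse).1.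
  rewrite (phiN _ (phiL _ _ bse).1) (phiL _ _ bse).2.
  rewrite subr_ge0 mulrBl lerBlDr => /le_trans.
  rewrite [phi (s e) * phi v]mulrC; apply.
  rewrite lerD2l /c mulrAC ler_pdivrMr ?ltr_wpDl//.
  by rewrite ler_wpM2l// ?ltW// ltrDl.
Qed.
End states.

(** * The Archimedean Positivstellensatz for modules over a semiring *)

Section semiring.
Variables (R : realType) (d k : nat) (f : 'I_k -> {mpoly R[d]}).
Notation C := (mpoly.mpolyC d).
Notation S := (gen_semiring f).

Lemma evalpD p q (x : 'rV[R]_d) : evalp (p + q) x = evalp p x + evalp q x.
Proof. exact: mpoly.mevalD. Qed.
Lemma evalpN p (x : 'rV[R]_d) : evalp (- p) x = - evalp p x.
Proof. exact: mpoly.mevalN. Qed.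
Lemma evalpM p q (x : 'rV[R]_d) : evalp (p * q) x = evalp p x * evalp q x.
Proof. exact: mpoly.mevalM. Qed.
Lemma evalpZ a p (x : 'rV[R]_d) : evalp (a *: p) x = a * evalp p x.
Proof. exact: mpoly.mevalZ. Qed.
Lemma evalpC a (x : 'rV[R]_d) : evalp (C a) x = a.
Proof. exact: mpoly.mevalC. Qed.
Lemma evalp1 (x : 'rV[R]_d) : evalp 1 x = 1.
Proof. exact: mpoly.meval1. Qed.
Lemma evalpX i (x : 'rV[R]_d) : evalp (mpoly.mpolyX R (mpoly.mnm1 i)) x = x ord0 i.
Proof. exact: mpoly.mevalXU. Qed.

(** Frees the index type, so that sums and products of generic elements can be
    indexed by sum and product types. *)
Lemma gen_semiring_fin (I : finType) (a : I -> R) (e : I -> 'I_k -> nat) :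
  (forall j, 0 <= a j) -> S (\sum_j a j *: \prod_(i < k) f i ^+ e j i).
Proof.
move=> a0; exists #|I|, (a \o enum_val), (e \o enum_val).
split => [j|]; first exact: a0.
by rewrite (reindex _ (onW_bij _ (enum_val_bij I))).
Qed.

Lemma gen_semiringD p q : S p -> S q -> S (p + q).
Proof.
move=> [n [a [e [a0 ->]]]] [m [b [e' [b0 ->]]]].
have := @gen_semiring_fin ('I_n + 'I_m)%type
  (fun j => match j with inl i => a i | inr i => b i end)
  (fun j => match j with inl i => e i | inr i => e' i end).
by rewrite big_sumType; apply => -[].
Qed.

Lemma gen_semiringM p q : S p -> S q -> S (p * q).
Proof.
move=> [n [a [e [a0 ->]]]] [m [b [e' [b0 ->]]]].
have := @gen_semiring_fin ('I_n * 'I_m)%type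
  (fun j => a j.1 * b j.2) (fun j i => (e j.1 i + e' j.2 i)%N).
rewrite -(pair_bigA _ (fun j1 j2 => (a j1 * b j2) *:
  \prod_(i < k) f i ^+ (e j1 i + e' j2 i)%N))/= big_distrl /=.
under eq_bigr => i _.
  under eq_bigr => j _.
    under eq_bigr => l _ do rewrite exprD.
    rewrite big_split /= -scalerA scalerAr scalerAl.
    over.
  rewrite -mulr_sumr.
  over.
by apply => j; rewrite mulr_ge0.
Qed.

Lemma gen_semiringC r : 0 <= r -> S (C r).
Proof.
move=> r0; exists 1, (fun=> r), (fun _ _ => 0); split => //.
rewrite big_ord1 big1; last by move=> i _; rewrite expr0.
by rewrite -mpoly.mul_mpolyC mulr1.
Qed.

Lemma gen_semiring1 : S 1.
Proof. by rewrite -mpoly.mpolyC1; exact: gen_semiringC. Qed.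

Lemma gen_semiring_gen i : S (f i).
Proof.
exists 1, (fun=> 1), (fun _ l => (l == i) : nat); split => //.
rewrite big_ord1 scale1r (bigD1 i)//= eqxx expr1 big1 ?mulr1//.
by move=> l /negbTE ->; rewrite expr0.
Qed.

Lemma gen_semiring_ge0 p x : S p -> nonneg_set f x -> 0 <= evalp p x.
Proof.
move=> [n [a [e [a0 ->]]]] fx.
rewrite /evalp rmorph_sum /=; apply: sumr_ge0 => j _.
rewrite mpoly.mevalZ mulr_ge0// rmorph_prod; apply: prodr_ge0 => i _.
by rewrite rmorphXn exprn_ge0//; exact: fx.
Qed.

Definition multiplications : set ({mpoly R[d]} -> {mpoly R[d]}) :=
  [set m | exists2 s, S s & m = fun v => s * v].

Lemma multiplications_cone : commuting_cone_of_operators multiplications.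
Proof.
split.
- by move=> _ [s Ss ->] a u v; rewrite mulrDr -scalerAr.
- by move=> _ _ [s Ss ->] [t St ->] v; rewrite mulrCA.
- move=> _ _ [s Ss ->] [t St ->]; exists (s + t); first exact: gen_semiringD.
  by apply/funext => v; rewrite mulrDl.
- move=> _ _ [s Ss ->] [t St ->]; exists (s * t); first exact: gen_semiringM.
  by apply/funext => v; rewrite mulrA.
- move=> r r0; exists (C r); first exact: gen_semiringC.
  by apply/funext => v; rewrite mpoly.mul_mpolyC.
Qed.

Definition smodule (M : set {mpoly R[d]}) :=
  (forall p q, M p -> M q -> M (p + q)) /\
  (forall s p, S s -> M p -> M (s * p)).

(** The point has the images of the variables as coordinates. *)
Lemma linear_multiplicative_is_evalp (phi : {mpoly R[d]} -> R) :
  phi 1 = 1 -> (forall a p q, phi (a *: p + q) = a * phi p + phi q) ->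
  (forall p q, phi (p * q) = phi p * phi q) ->
  exists x : 'rV[R]_d, forall p, phi p = evalp p x.
Proof.
move=> phi1 phiL phiM.
have phi0 : phi 0 = 0 by have := phiL (-1) 0 0; rewrite scaler0 addr0 mulN1r addNr.
pose x : 'rV[R]_d := \row_i phi (mpoly.mpolyX R (mpoly.mnm1 i)).
have phiX m : phi (mpoly.mpolyX R m) = evalp (mpoly.mpolyX R m) x.
  rewrite /evalp mpoly.mevalX mpoly.mpolyXE_id.
  rewrite (big_morph phi phiM phi1); apply: eq_bigr => i _.
  rewrite mxE; elim: (mpoly.fun_of_multinom m i) => [|n IH]; first by rewrite !expr0.
  by rewrite !exprS phiM IH.
exists x; elim/mpoly.mpolyind => [|c m p _ _ IH].
  by rewrite phi0 /evalp mpoly.meval0.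
by rewrite phiL IH phiX evalpD evalpZ.
Qed.

Hypothesis hf : archimedean_semiring S.

(** Since the semiring is Archimedean, constants dominate every polynomial and
    any polynomial becomes a semiring element after adding a constant; so
    multiplicativity on the semiring extends to all products. *)
Theorem proper_smodule_has_point M : smodule M -> M 1 -> ~ M (-1) ->
  exists x, forall p, M p -> 0 <= evalp p x.
Proof.
move=> [MD MM] M1 nM1.
have opM : op_module multiplications M.
  by split => // _ [s Ss ->] p Mp; exact: MM.
have SM s : S s -> M s by move=> Ss; rewrite -[s]mulr1; exact: MM.
have bnd p : bounded_by 1 M p.
  have [l1 l10 H1] := hf p; have [l2 l20 H2] := hf (- p).
  exists (l1 + l2); rewrite -[_ *: 1]mpoly.mul_mpolyC mulr1 mpoly.mpolyCD; split.
    rewrite addrAC; apply: MD; apply: SM => //.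
    by apply: gen_semiringC; exact: ltW.
  rewrite -addrA; apply: MD; apply: SM; last by rewrite opprK in H2.
  by apply: gen_semiringC; exact: ltW.
have [phi [phi1 phi_ge0 phiL phiS]] :=
  exists_multiplicative_state multiplications_cone opM M1 nM1.
have {}phiL a p q := phiL a p q (bnd p) (bnd q).
have {}phiS s p : S s -> phi (s * p) = phi s * phi p.
  move=> Ss; rewrite -[phi s in RHS]mulr1 -?phi1.
  have := phiS _ p (ex_intro2 _ _ s Ss erefl) (bnd _) (bnd _) (bnd _).
  by rewrite mulr1 phi1 mulr1.
have phiM p q : phi (p * q) = phi p * phi q.
  have [l l0] := hf (- p); rewrite opprK => Slp.
  have -> : p = (- l) *: 1 + (C l + p).
    by rewrite scaleNr -mpoly.mul_mpolyC mulr1 addKr.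
  rewrite mulrDl -scalerAl mul1r !phiL phiS// phi1; ring.
have [x phiE] := linear_multiplicative_is_evalp phi1 phiL phiM.
by exists x => p Mp; rewrite -phiE; exact: phi_ge0.
Qed.

(** The points where the whole of [M] is nonnegative form the set on which [h] is
    assumed positive.  No such point is compatible with the module [M - S h], which
    therefore contains [-1]. *)
Theorem positivstellensatz_smodule M h : smodule M -> M 1 ->
  (forall x, (forall p, M p -> 0 <= evalp p x) -> 0 < evalp h x) -> M h.
Proof.
move=> MS M1 hpos; have [MD MM] := MS.
have SM s : S s -> M s by move=> Ss; rewrite -[s]mulr1; exact: MM.
pose N := [set q | exists c s, [/\ M c, S s & q = c - s * h]].
have S0 : S 0 by rewrite -mpoly.mpolyC0; exact: gen_semiringC.
have NS : smodule N.
  split.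
    move=> _ _ [c [s [Mc Ss ->]]] [c' [s' [Mc' Ss' ->]]].
    exists (c + c'), (s + s'); split; [exact: MD|exact: gen_semiringD|ring].
  move=> t _ St [c [s [Mc Ss ->]]].
  exists (t * c), (t * s); split; [exact: MM|exact: gen_semiringM|ring].
have MN q : M q -> N q by move=> Mq; exists q, 0; split => //; ring.
have : N (- 1).
  apply: contrapT => /(proper_smodule_has_point NS (MN _ M1))[x xN].
  have : 0 < evalp h x by apply: hpos => p /MN; exact: xN.
  have : 0 <= evalp (- h) x.
    apply: xN; exists 0, 1; split; [exact: SM|exact: gen_semiring1|ring].
  by rewrite evalpN oppr_ge0 leNgt => /negbTE ->.
move=> [c [s [Mc Ss E]]].
have {c Mc E} Msh : M (s * h - 1).
  by rewrite (_ : _ - 1 = c)// E; ring.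
have [l l0 Sls] := hf s.
(* From [s h - 1], [h + r] and [l - s] in the cone, the combination
   [(l - s)(h + r) + (s h - 1) + r s = l (h + r) - 1] is in the cone too. *)
have step r : 0 <= r -> M (h + C r) -> M (h + C (r - l^-1)).
  move=> r0 Mr.
  have : M (C l^-1 * ((C l - s) * (h + C r) + ((s * h - 1) + s * C r))).
    apply: (MM _ _); first by apply: gen_semiringC; rewrite invr_ge0 ltW.
    apply: (MD _ _); first exact: MM.
    by apply: MD => //; apply: SM; apply: gen_semiringM => //; exact: gen_semiringC.
  congr M; have Cl : C l^-1 * C l = 1.
    by rewrite -mpoly.mpolyCM mulVf ?gt_eqF// mpoly.mpolyC1.
  transitivity (C l^-1 * (C l * (h + C r) - 1)); first by ring.
  by rewrite mulrBr mulr1 mulrA Cl mul1r mpoly.mpolyCB addrA.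
have [r0 r00] := hf (- h); rewrite opprK addrC => Sh.
(* The maximum with [0] is needed since [step] starts from [r >= 0] only. *)
have iter n : exists r, [/\ r <= Num.max 0 (r0 - l^-1 *+ n), 0 <= r & M (h + C r)].
  elim: n => [|n [r [rn rge Mr]]].
    by exists r0; split; [rewrite mulr0n subr0 le_max lexx orbT|exact: ltW|exact: SM].
  have [rl|rl] := leP l^-1 r.
    exists (r - l^-1); split; [|by rewrite subr_ge0|exact: step].
    rewrite mulrSr opprD addrA.
    have : r <= r0 - l^-1 *+ n.
      move: rn; rewrite le_max => /orP[|//]; rewrite leNgt (lt_le_trans _ rl)//.
      by rewrite invr_gt0.
    by rewrite le_max lerD2r => ->; rewrite orbT.
  exists 0; split => //; first by rewrite le_max lexx.
  rewrite (_ : h + C 0 = (h + C (r - l^-1)) + C (l^-1 - r)).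
    apply: MD; first exact: step.
    by apply: SM; apply: gen_semiringC; rewrite subr_ge0 ltW.
  by rewrite -addrA -mpoly.mpolyCD; congr (h + C _); ring.
have [r [rn rge]] := iter (Num.bound (r0 * l)).
suff -> : r = 0 by rewrite mpoly.mpolyC0 addr0.
apply/eqP; rewrite eq_le rge andbT; apply: le_trans rn _.
rewrite ge_max lexx/= subr_le0 -mulr_natl ler_pdivlMr//.
by apply/ltW/archi_boundP; rewrite mulr_ge0 ?ltW.
Qed.

End semiring.

Section cone.
Variables (R : realType) (d k r : nat).
Variables (f : 'I_k -> {mpoly R[d]}) (g : 'I_r.+1 -> {mpoly R[d]}).
Hypothesis hg0 : g ord0 = 1.
Hypothesis hf : archimedean_semiring (gen_semiring f).
Let K := nonneg_set f `&` nonneg_set g.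

Lemma semiring_cone_smodule : smodule f (semiring_cone f g).
Proof.
split.
  move=> _ _ [s [Ss ->]] [t [St ->]]; exists (fun j => s j + t j); split.
    by move=> j; exact: gen_semiringD.
  by rewrite -big_split; apply: eq_bigr => j _; rewrite mulrDr.
move=> t _ St [s [Ss ->]]; exists (fun j => t * s j); split.
  by move=> j; exact: gen_semiringM.
by rewrite mulr_sumr; apply: eq_bigr => j _; rewrite mulrCA.
Qed.

Lemma semiring_cone_gen j : semiring_cone f g (g j).
Proof.
exists (fun i => mpoly.mpolyC d (i == j)%:R); split.
  by move=> i; apply: gen_semiringC.
rewrite (bigD1 j)//= eqxx mpoly.mpolyC1 mulr1 big1 ?addr0// => i /negbTE ->.
by rewrite mpoly.mpolyC0 mulr0.
Qed.

Lemma semiring_cone1 : semiring_cone f g 1.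
Proof. by rewrite -hg0; exact: semiring_cone_gen. Qed.

Lemma semiring_sub_cone s : gen_semiring f s -> semiring_cone f g s.
Proof.
move=> Ss; rewrite -[s]mulr1; apply: semiring_cone_smodule.2 => //.
exact: semiring_cone1.
Qed.

Theorem positivstellensatz h : (forall x, K x -> 0 < evalp h x) -> semiring_cone f g h.
Proof.
move=> hpos; apply: (positivstellensatz_smodule hf) => //.
- exact: semiring_cone_smodule.
- exact: semiring_cone1.
- move=> x xM; apply: hpos; split=> i; apply: xM.
    by apply: semiring_sub_cone; exact: gen_semiring_gen.
  exact: semiring_cone_gen.
Qed.
End cone.

(** * Polynomials on a compact basic closed set *)

Section poly_top.
Variables (R : realType) (d : nat).

Lemma mpoly_alg_ind (P : {mpoly R[d]} -> Prop) :
  (forall c, P (mpoly.mpolyC d c)) ->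
  (forall i, P (mpoly.mpolyX R (mpoly.mnm1 i))) ->
  (forall p q, P p -> P q -> P (p + q)) ->
  (forall p q, P p -> P q -> P (p * q)) -> forall p, P p.
Proof.
move=> PC PX PD PM; elim/mpoly.mpolyind => [|c m p _ _ Pp].
  by rewrite -mpoly.mpolyC0.
apply: (PD _ _) => //; rewrite -mpoly.mul_mpolyC; apply: (PM _ _) => //.
rewrite mpoly.mpolyXE_id; elim/big_ind: _ => [|//|i _].
- by rewrite -mpoly.mpolyC1.
- elim: (mpoly.fun_of_multinom m i) => [|n IH]; first by rewrite expr0 -mpoly.mpolyC1.
  by rewrite exprS; apply: PM.
Qed.

Lemma evalp_continuous (p : {mpoly R[d]}) : continuous (evalp p).
Proof.
elim/mpoly_alg_ind: p => [c|i|p q cp cq|p q cp cq] x.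
- rewrite (_ : evalp _ = fun=> c); first exact: cst_continuous.
  by apply/funext => y; rewrite evalpC.
- rewrite (_ : evalp _ = fun y => y ord0 i); first exact: coord_continuous.
  by apply/funext => y; rewrite evalpX.
- rewrite (_ : evalp _ = fun y => evalp p y + evalp q y).
    exact: cvgD (cp x) (cq x).
  by apply/funext => y; rewrite evalpD.
- rewrite (_ : evalp _ = fun y => evalp p y * evalp q y).
    exact: cvgM (cp x) (cq x).
  by apply/funext => y; rewrite evalpM.
Qed.

Lemma nonneg_set_closed m (p : 'I_m -> {mpoly R[d]}) : closed (nonneg_set p).
Proof.
rewrite (_ : nonneg_set p = \bigcap_i (evalp (p i) @^-1` [set r | 0 <= r])).
  apply: closed_bigI => i _; apply: preimage_closed => [x _|]; last exact: closed_ge.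
  exact: evalp_continuous.
by apply/seteqP; split => [x px i _|x px i]; exact: px.
Qed.

(** Both [l - x_i] and [m + x_i] are in the semiring for suitable constants, so
    each coordinate is bounded. *)
Lemma archimedean_compact k (f : 'I_k -> {mpoly R[d]}) :
  archimedean_semiring (gen_semiring f) -> compact (nonneg_set f).
Proof.
move=> hf; pose X i := mpoly.mpolyX R (mpoly.mnm1 i) : {mpoly R[d]}.
have /choice[B hB] (i : 'I_d) :
    exists B, forall x, nonneg_set f x -> - B <= x ord0 i <= B.
  have [l l0 Sl] := hf (X i); have [m m0 Sm] := hf (- X i).
  exists (l + m) => x fx.
  have := gen_semiring_ge0 Sl fx; have := gen_semiring_ge0 Sm fx.
  by rewrite !evalpD !evalpN !evalpC evalpX; lra.
apply: (subclosed_compact (@nonneg_set_closed _ f)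
  (@rV_compact _ _ (fun i => `[- B i, B i]%classic) _)).
  by move=> i; exact: segment_compact.
by move=> x fx i; rewrite /= in_itv/=; exact: hB.
Qed.
End poly_top.

(** Adding a small positive constant makes the polynomial strictly positive. *)
Lemma positive_on_nonneg_polys (R : realType) (d k r : nat)
  (f : 'I_k -> {mpoly R[d]}) (g : 'I_r.+1 -> {mpoly R[d]})
  (L : {scalar {mpoly R[d]}}) :
  g ord0 = 1 -> archimedean_semiring (gen_semiring f) ->
  (forall p, semiring_cone f g p -> 0 <= L p) ->
  forall p, (forall x, (nonneg_set f `&` nonneg_set g) x -> 0 <= evalp p x) -> 0 <= L p.
Proof.
move=> hg0 hf Lpos p ppos.
have L1 : 0 <= L 1 by apply: Lpos; exact: semiring_cone1.
apply/ler_addgt0Pr => e e0.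
have c0 : 0 < e / (L 1 + 1) by rewrite divr_gt0// ltr_wpDl.
have : 0 <= L (p + (e / (L 1 + 1)) *: 1).
  apply/Lpos/positivstellensatz => // x Kx.
  by rewrite evalpD evalpZ evalp1 mulr1 ltr_wpDl// ppos.
rewrite linearD linearZ /= => /le_trans; apply.
rewrite lerD2l mulrAC ler_pdivrMr ?ltr_wpDl//.
by rewrite ler_wpM2l// ?ltW// ltrDl.
Qed.

(** * Extension of positive functionals to bounded functions *)

Definition bounded_fun_on (R : realType) (T : Type) (K : set T) (u : T -> R) :=
  exists M, forall x, K x -> `|u x| <= M.

Definition positive_functional_on (R : realType) (T : Type) (K : set T)
    (Lambda : (T -> R) -> R) :=
  (forall a u v, bounded_fun_on K u -> bounded_fun_on K v ->
     Lambda (a *: u + v) = a * Lambda u + Lambda v) /\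
  (forall u, bounded_fun_on K u -> (forall x, K x -> 0 <= u x) -> 0 <= Lambda u).

Definition scalings (R : realType) (V : lmodType R) : set (V -> V) :=
  [set m | exists2 r, 0 <= r & m = fun v => r *: v].

Lemma scalings_cone (R : realType) (V : lmodType R) :
  commuting_cone_of_operators (@scalings R V).
Proof.
split.
- by move=> _ [s s0 ->] a u v; rewrite scalerDr !scalerA mulrC.
- by move=> _ _ [s _ ->] [t _ ->] v; rewrite !scalerA mulrC.
- move=> _ _ [s s0 ->] [t t0 ->]; exists (s + t); first exact: addr_ge0.
  by apply/funext => v; rewrite scalerDl.
- move=> _ _ [s s0 ->] [t t0 ->]; exists (s * t); first exact: mulr_ge0.
  by apply/funext => v; rewrite scalerA.
- by move=> r r0; exists r.
Qed.

(** The cone consists of the functions that dominate on [K] some [J w] with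
    [L w >= 0].  It contains [J w] and [- J w] whenever [L w = 0], so the normalised
    state vanishes on the kernel of [L] and is proportional to [L]. *)
Theorem positive_extension (R : realType) (T : Type) (K : set T) (W : lmodType R)
    (J : W -> T -> R) (L : {scalar W}) (w1 : W) :
  (forall a u v x, J (a *: u + v) x = a * J u x + J v x) ->
  (forall w, bounded_fun_on K (J w)) ->
  (forall x, J w1 x = 1) -> 0 < L w1 ->
  (forall w, (forall x, K x -> 0 <= J w x) -> 0 <= L w) ->
  exists Lambda, positive_functional_on K Lambda /\ forall w, Lambda (J w) = L w.
Proof.
move=> Jlin Jbd J1 L1 Lpos.
have J0 x : J 0 x = 0 by have := Jlin (-1) 0 0 x; rewrite scaler0 addr0 mulN1r addNr.
have JN w x : J (- w) x = - J w x.
  by have := Jlin (-1) w 0 x; rewrite addr0 scaleN1r J0 addr0 mulN1r.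
have JD u v x : J (u + v) x = J u x + J v x.
  by have := Jlin 1 u v x; rewrite scale1r mul1r.
pose e : T -> R := fun=> 1.
pose P0 := [set v : T -> R | exists w, 0 <= L w /\ forall x, K x -> J w x <= v x].
have PM0 : op_module (@scalings R (T -> R)) P0.
  split.
    move=> u v [w [Lw wu]] [w' [Lw' wv]]; exists (w + w'); split.
      by rewrite linearD addr_ge0.
    by move=> x Kx; rewrite JD; exact: lerD (wu _ Kx) (wv _ Kx).
  move=> _ [s s0 ->] v [w [Lw wv]]; exists (s *: w); split.
    by rewrite linearZ mulr_ge0.
  move=> x Kx; have := Jlin s w 0 x; rewrite addr0 J0 addr0 => ->.
  by rewrite ler_wpM2l// wv.
have P0_of v : (forall x, K x -> 0 <= v x) -> P0 v.
  by move=> v0; exists 0; rewrite linear0; split => // x Kx; rewrite J0; exact: v0.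
have P0e : P0 e by apply: P0_of.
have nP0e : ~ P0 (- e).
  move=> [w [Lw we]].
  have : 0 <= L (- w - w1).
    apply: Lpos => x Kx; rewrite JD !JN J1.
    have := we x Kx; rewrite (_ : (- e) x = -1)//; lra.
  rewrite linearB linearN/=; lra.
have bnd u : bounded_fun_on K u -> bounded_by e P0 u.
  move=> [M uM]; exists M; split; apply: P0_of => x Kx.
    rewrite (_ : (_ - _) x = M * 1 - u x)//.
    by rewrite mulr1 subr_ge0 (le_trans (ler_norm _))// uM.
  rewrite (_ : (_ + _) x = M * 1 + u x)//.
  by rewrite mulr1 -lerBlDr sub0r (le_trans (ler_norm _))// normrN uM.
have [phi [phi1 phipos philin _]] :=
  exists_multiplicative_state (@scalings_cone R (T -> R)) PM0 P0e nP0e.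
exists (fun u => L w1 * phi u); split; first split.
- by move=> a u v /bnd bu /bnd bv; rewrite philin//; ring.
- move=> u /bnd bu u0; apply: mulr_ge0; first exact: ltW.
  by apply: phipos => //; exact: P0_of.
move=> w; pose w' := (- (L w / L w1)) *: w1 + w.
have Lw' : L w' = 0.
  by rewrite /w' linearD linearZ /= mulNr mulfVK ?gt_eqF// addNr.
have J'E : J w' = (- (L w / L w1)) *: e + J w.
  by apply/funext => x; rewrite Jlin J1.
have be : bounded_by e P0 e by apply: bnd; exists 1 => x _; rewrite normr1.
have phi_ker v : L v = 0 -> 0 <= phi (J v).
  by move=> Lv; apply: phipos; [exact/bnd/Jbd|exists v; rewrite Lv].
have E2 : J (- w') = (-1) *: J w' + 0.
  by apply/funext => x; rewrite addr0 JN; exact: esym (mulN1r _).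
have b0 : bounded_by e P0 0 by apply: bnd; exists 0 => x _; rewrite normr0.
have phi0 : phi 0 = 0.
  by have := philin (-1) 0 0 b0 b0; rewrite scaler0 addr0 mulN1r addNr.
have ge : 0 <= phi (J w') := phi_ker _ Lw'.
have : 0 <= phi (J (- w')) by apply: phi_ker; rewrite linearN Lw' oppr0.
rewrite E2 (philin _ _ _ (bnd _ (Jbd _)) b0) phi0 addr0 mulN1r oppr_ge0 => le.
have : phi (J w') = 0 by apply/eqP; rewrite eq_le le ge.
rewrite J'E (philin _ _ _ be (bnd _ (Jbd _))) phi1 mulr1 addrC => /eqP.
by rewrite subr_eq0 => /eqP ->; rewrite mulrC mulfVK// gt_eqF.
Qed.

(** * Binary cells and the quantile map *)

Section coding.
Variables (T : Type) (b : nat -> T -> bool).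

(** The answers to the first [n] questions, read as a binary number whose last
    digit is the most recent answer: the cell of depth [n] numbered [j] is cut
    into the cells of depth [n + 1] numbered [2 j] and [2 j + 1]. *)
Fixpoint bitcode (n : nat) (x : T) : nat :=
  if n is m.+1 then ((bitcode m x).*2 + b m x)%N else 0%N.

Lemma bitcode_lt n x : (bitcode n x < 2 ^ n)%N.
Proof. by elim: n => //= n IH; rewrite expnS; case: (b n x); lia. Qed.

Lemma bitcode_div n m x : bitcode n x = (bitcode (n + m) x %/ 2 ^ m)%N.
Proof.
elim: m => [|m IH]; first by rewrite addn0 divn1.
rewrite IH addnS expnS divnMA /=; congr (_ %/ _)%N.
by case: (b _ x); lia.
Qed.

Lemma bitcode_bit n m x y : bitcode n x = bitcode n y -> (m < n)%N -> b m x = b m y.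
Proof.
move=> E mn; have : bitcode m.+1 x = bitcode m.+1 y.
  by rewrite !(bitcode_div m.+1 (n - m.+1)) subnKC// E.
by move=> /= /(congr1 odd); rewrite !oddD !odd_double/=; case: (b m x); case: (b m y).
Qed.
End coding.

Section quantile.
Variables (R : realType) (T : Type) (K : set T) (Lambda : (T -> R) -> R).
Variable b : nat -> T -> bool.
Hypothesis HL : positive_functional_on K Lambda.
Local Notation c := (bitcode b).

Lemma bounded_ind (P : T -> bool) : bounded_fun_on K (fun x => (P x)%:R : R).
Proof. by exists 1 => x _; case: (P x); rewrite ?normr1 ?normr0. Qed.

Lemma functional0 : Lambda 0 = 0.
Proof.
have b0 : bounded_fun_on K (0 : T -> R) by exists 0 => x _; rewrite normr0.
by have := HL.1 (-1) 0 0 b0 b0; rewrite scaler0 addr0 mulN1r addNr.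
Qed.

Lemma functionalB u v : bounded_fun_on K u -> bounded_fun_on K v ->
  Lambda (fun x => u x - v x) = Lambda u - Lambda v.
Proof.
move=> bu bv; rewrite (_ : (fun _ => _) = (-1) *: v + u).
  by rewrite HL.1// mulN1r addrC.
by apply/funext => x; rewrite [LHS]addrC -[- v x]mulN1r.
Qed.

Lemma bounded_funB u v : bounded_fun_on K u -> bounded_fun_on K v ->
  bounded_fun_on K (fun x => u x - v x : R).
Proof.
move=> [M uM] [N vN]; exists (M + N) => x Kx.
by rewrite (le_trans (ler_normB _ _))// lerD ?uM ?vN.
Qed.

Lemma functional_le u v : bounded_fun_on K u -> bounded_fun_on K v ->
  (forall x, K x -> u x <= v x) -> Lambda u <= Lambda v.
Proof.
move=> bu bv uv; rewrite -subr_ge0 -functionalB//.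
by apply: HL.2 => [|x Kx]; [exact: bounded_funB|rewrite subr_ge0 uv].
Qed.

(** A cumulative distribution function along the numbering of the cells. *)
Definition cumul n j : R := Lambda (fun x => (c n x < j)%N%:R).
Definition mass : R := Lambda (fun=> 1).
(** An interval of levels that the quantile map will send into the closure of
    cell [j]; half-open, so that the slots of one depth are disjoint. *)
Definition slot n j (t : R) := cumul n j <= t < cumul n j.+1.

Lemma cumul0 n : cumul n 0 = 0.
Proof. exact: functional0. Qed.

Lemma cumul_max n : cumul n (2 ^ n) = mass.
Proof. by congr Lambda; apply/funext => x; rewrite bitcode_lt. Qed.

Lemma cumul_le n : {homo cumul n : i j / (i <= j)%N >-> i <= j}.
Proof.
move=> i j ij; apply: functional_le => [||x _]; try exact: bounded_ind.
by rewrite ler_nat; case: ltnP => // /leq_trans/(_ ij) ->.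
Qed.

Lemma cumul_refine n m j : cumul (n + m) (j * 2 ^ m) = cumul n j.
Proof.
congr Lambda; apply/funext => x.
by rewrite (bitcode_div b n m) ltn_divLR// expn_gt0.
Qed.

Lemma cumul_cell n j : Lambda (fun x => (c n x == j)%:R) = cumul n j.+1 - cumul n j.
Proof.
rewrite -functionalB; try exact: bounded_ind.
congr Lambda; apply/funext => x; rewrite ltnS.
by case: ltngtP => _; rewrite ?subrr ?subr0.
Qed.

Lemma slot_exists n t : 0 <= t < mass -> exists2 j, (j < 2 ^ n)%N & slot n j t.
Proof.
move=> /andP[t0 tM].
have ex : exists j, t < cumul n j.+1.
  by exists (2 ^ n).-1; rewrite prednK ?expn_gt0// cumul_max.
case: (ex_minnP ex) => j tj jmin; exists j.
  rewrite -ltnS -(@prednK (2 ^ n)) ?expn_gt0// ltnS -ltnS prednK ?expn_gt0//.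
  have := jmin (2 ^ n).-1; rewrite prednK ?expn_gt0// cumul_max => /(_ tM).
  by rewrite -ltnS prednK ?expn_gt0.
rewrite /slot tj andbT; case: j tj jmin => [|j] _ jmin; first by rewrite cumul0.
by rewrite leNgt; apply/negP => /jmin; rewrite ltnn.
Qed.

Lemma slot_bounds n j t : slot n j t -> 0 <= t < mass.
Proof.
move=> /andP[jt tj]; rewrite (le_trans _ jt) -?(cumul0 n) ?cumul_le//=.
apply: (lt_le_trans tj); apply: functional_le => [||x _].
- exact: bounded_ind.
- by exists 1 => x _; rewrite normr1.
- by case: ltnP.
Qed.

Lemma slot_uniq n i j t : slot n i t -> slot n j t -> i = j.
Proof.
wlog: i j / (i < j)%N => [H|ij] si sj.
  have [/H H1|/H H1|//] := ltngtP i j; first exact: H1.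
  by apply/esym/H1.
move: si sj => /andP[_ ti] /andP[jt _]; exfalso.
by have := lt_le_trans ti (le_trans (cumul_le n ij) jt); rewrite ltxx.
Qed.

Lemma slot_refine n m j t : slot (n + m) j t -> slot n (j %/ 2 ^ m) t.
Proof.
move=> /andP[jt tj]; rewrite /slot -!(cumul_refine n m); apply/andP; split.
  by apply: le_trans jt; apply: cumul_le; exact: leq_trunc_div.
apply: (lt_le_trans tj); apply: cumul_le.
by rewrite -ltn_divLR ?expn_gt0.
Qed.

Lemma slot_cell n j t : slot n j t -> exists2 x, K x & c n x = j.
Proof.
move=> /andP[jt tj]; apply: contrapT => nx.
have : cumul n j.+1 - cumul n j <= 0.
  rewrite -cumul_cell -functional0; apply: functional_le.
  - exact: bounded_ind.
  - by exists 0 => x _; rewrite normr0.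
  - by move=> x Kx; case: eqP => // E; exfalso; apply: nx; exists x.
by rewrite subr_le0 leNgt (le_lt_trans jt tj).
Qed.

End quantile.

Section quantile_top.
Variables (R : realType) (T : pseudoPMetricType R) (K : set T).
Variable Lambda : (T -> R) -> R.
Variable b : nat -> T -> bool.
Hypothesis HL : positive_functional_on K Lambda.
Hypothesis cK : compact K.
Local Notation c := (bitcode b).
Local Notation slot := (slot Lambda b).
Local Notation mass := (mass Lambda).

(** Pick a point in the cell of each depth whose slot contains [t].  From depth [n] on
    these points stay in one cell of depth [n], so an accumulation point of
    the sequence adheres to every cell. *)
Lemma quantile_point t : 0 <= t < mass -> exists2 x, K x &
  forall n j, slot n j t -> closure (K `&` [set y | c n y = j]) x.
Proof.
move=> t0M.
have /choice[J HJ] n : exists j, slot n j t.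
  by have [j _ ?] := slot_exists b HL n t0M; exists j.
have /choice[y Hy] n : exists y, K y /\ c n y = J n.
  by have [y Ky yE] := slot_cell HL (HJ n); exists y.
have [x [Kx clx]] := cK (F := y @ \oo) _ (filterE _ (fun n => (Hy n).1)).
exists x => // n j sj; move=> U Ux.
have [] := clx [set z | K z /\ c n z = j] U _ Ux; last by move=> z; exists z.
exists n => // m /= nm; split; first exact: (Hy m).1.
rewrite (bitcode_div b n (m - n)) subnKC// (Hy m).2.
apply: (slot_uniq HL _ sj); apply: (slot_refine HL).
by rewrite subnKC.
Qed.

Lemma quantile_exists (x0 : T) : K x0 -> exists X : R -> T,
  [/\ forall t, K (X t), forall t, ~~ (0 <= t < mass) -> X t = x0 &
   forall n j t, slot n j t -> closure (K `&` [set y | c n y = j]) (X t)].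
Proof.
move=> Kx0.
have /choice[X HX] (t : R) : exists x, [/\ K x, ~~ (0 <= t < mass) -> x = x0 &
    forall n j, slot n j t -> closure (K `&` [set y | c n y = j]) x].
  have [tM|tM] := boolP (0 <= t < mass).
    by have [x Kx xP] := quantile_point tM; exists x.
  exists x0; split => // n j /(slot_bounds HL) tM'; by rewrite tM' in tM.
by exists X; split => [t|t|n j t]; have [? ? ?] := HX t; auto.
Qed.

(** Ask, for every [m], membership in each ball of a finite cover of [K] by
    balls of radius [1 / (m + 1)]; the questions are enumerated through the
    countability of pairs.  Points with the same answers share a ball. *)
Lemma compact_small_cells_bits : exists b : nat -> T -> bool,
  forall e, 0 < e -> exists n, forall x y, K x -> K y ->
    bitcode b n x = bitcode b n y -> ball x e y.
Proof.
have /choice[s Hs] (m : nat) : exists s : seq T, forall x, K x ->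
    exists2 i, (i < size s)%N & ball (nth x s i) m.+1%:R^-1 x.
  have : cover_compact K by rewrite -compact_cover.
  move=> /(_ T K (fun x => (ball x m.+1%:R^-1)°)).
  case.
  - by move=> x _; exact: open_interior.
  - move=> x Kx; exists x => //; apply: nbhsx_ballx.
    by rewrite invr_gt0.
  move=> D DK KD; exists (finmap.enum_fset D) => x Kx.
  have [y /= yD yx] := KD _ Kx.
  exists (index y (finmap.enum_fset D)); first by rewrite index_mem.
  by rewrite nth_index//; exact: interior_subset yx.
exists (fun (n : nat) x => if (unpickle n : option (nat * nat)) is Some (m, i)
   then (i < size (s m))%N && `[< ball (nth x (s m) i) m.+1%:R^-1 x >] else false).
move=> e e0.
have [m _ me] : exists2 m, True & (m.+1%:R^-1 : R) < e / 2.
  have [m mE] := ltr_add_invr (y := 0 : R) (x := e / 2) (divr_gt0 e0 (ltr0Sn R 1)).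
  by exists m => //; rewrite add0r in mE.
exists (\max_(i < size (s m)) (pickle (m, (i : nat))).+1)%N => x y Kx Ky E.
have [i is_ xi] := Hs m _ Kx.
have /(bitcode_bit E) :
    (pickle (m, i) < \max_(i < size (s m)) (pickle (m, (i : nat))).+1)%N.
  exact: (@leq_bigmax _ (fun i : 'I_(size (s m)) => (pickle (m, (i : nat))).+1)
    (Ordinal is_)).
rewrite /= pickleK is_ /=.
have -> : `[< ball (nth x (s m) i) m.+1%:R^-1 x >] by apply/asboolP.
move=> /esym/asboolP; rewrite (set_nth_default x y)// => yi.
apply: (@ball_split _ _ (nth x (s m) i)).
  by apply: ball_sym; apply: le_ball xi; exact: ltW.
by apply: le_ball yi; exact: ltW.
Qed.

Hypothesis small : forall e, 0 < e -> exists n, forall x y, K x -> K y ->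
  c n x = c n y -> ball x e y.

(** Otherwise pairs of points of ever deeper cells would have images more than
    [e] apart; near an accumulation point of the first components this
    contradicts continuity. *)
Lemma uniform_on_cells (u : T -> R) : (forall x, K x -> {for x, continuous u}) ->
  forall e, 0 < e -> exists n, forall x y, K x -> K y -> c n x = c n y ->
    `|u x - u y| <= e.
Proof.
move=> cu e e0; apply: contrapT => nex.
have /choice[z Hz] n : exists z : T * T, [/\ K z.1, K z.2, c n z.1 = c n z.2 &
    e < `|u z.1 - u z.2|].
  apply: contrapT => nz; apply: nex; exists n => x y Kx Ky E.
  by rewrite leNgt; apply/negP => exy; apply: nz; exists (x, y).
have KP : (fst \o z @ \oo) K.
  by exists 0%N => // n _; have [] := Hz n.
have [x [Kx clx]] := cK (F := fst \o z @ \oo) _ KP.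
have /cvgrPdist_lt/(_ (e / 2) (divr_gt0 e0 (ltr0Sn R 1)))/nbhs_ballP[d /= d0 du] := cu _ Kx.
have [n nd] := small (divr_gt0 d0 (ltr0Sn R 1)).
have [] := clx [set y | exists2 m, (n <= m)%N & y = (z m).1] (ball x (d / 2)).
- by exists n => // m nm; exists m.
- by apply: nbhsx_ballx; rewrite divr_gt0.
move=> _ [[m nm ->] xzm].
have [K1 K2 E] := Hz m; rewrite ltNge => /negP; apply.
have zz : ball (z m).1 (d / 2) (z m).2.
  apply: nd => //.
  by rewrite !(bitcode_div b n (m - n)) subnKC// E.
have h1 : `|u x - u (z m).1| < e / 2.
  by apply: du; apply: le_ball xzm; rewrite ler_pdivrMr// ler_peMr ?ltW// ltr1n.
have h2 : `|u x - u (z m).2| < e / 2 by apply: du; exact: ball_split xzm zz.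
rewrite (_ : _ - _ = (u x - u (z m).2) - (u x - u (z m).1)); last by ring.
by rewrite (le_trans (ler_normB _ _))// [leRHS]splitr lerD// ltW.
Qed.

End quantile_top.

(** * The measure representing a positive functional *)

Section riesz.
Variables (R : realType) (T : pseudoPMetricType R) (K : set T).
Variables (Lambda : (T -> R) -> R) (b : nat -> T -> bool) (x0 : T) (X : R -> T).
Hypothesis HL : positive_functional_on K Lambda.
Hypothesis hT : hausdorff_space T.
Hypothesis cK : compact K.
Hypothesis Kx0 : K x0.
Local Notation c := (bitcode b).
Local Notation slot := (slot Lambda b).
Local Notation cumul := (cumul Lambda b).
Local Notation mass := (mass Lambda).
Local Notation borel := (g_sigma_algebraType (@open T)).
Local Notation lam := (@lebesgue_measure R).
Hypothesis small : forall e, 0 < e -> exists n, forall x y, K x -> K y ->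
  c n x = c n y -> ball x e y.
Hypothesis KX : forall t, K (X t).
Hypothesis Xout : forall t, ~~ (0 <= t < mass) -> X t = x0.
Hypothesis Xcl : forall n j t, slot n j t -> closure (K `&` [set y | c n y = j]) (X t).

Lemma slotE n j : [set t | slot n j t] = `[cumul n j, cumul n j.+1[%classic.
Proof. by apply/seteqP; split => t; rewrite /= in_itv. Qed.

Lemma measurable_slot n j : measurable ([set t | slot n j t] : set R).
Proof. by rewrite slotE; exact: measurable_itv. Qed.

Lemma X_near e : 0 < e -> exists n, forall j t t', slot n j t -> slot n j t' ->
  ball (X t) e (X t').
Proof.
move=> e0; have e2 : 0 < e / 2 by rewrite divr_gt0.
have e4 : 0 < e / 2 / 2 by rewrite divr_gt0.
have [n Hn] := small e2; exists n => j t t' st st'.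
have [y [[Ky yj] ty]] := Xcl st (nbhsx_ballx _ _ e4).
have [y' [[Ky' yj'] ty']] := Xcl st' (nbhsx_ballx _ _ e4).
have -> : e = e / 2 / 2 + (e / 2 + e / 2 / 2) by field.
apply: ball_triangle ty _; apply: (@ball_triangle _ _ y'); last exact: ball_sym.
by apply: Hn => //; rewrite yj yj'.
Qed.

Lemma X_cell (u : T -> R) n e : continuous u ->
  (forall x y, K x -> K y -> c n x = c n y -> `|u x - u y| <= e) ->
  forall j t x, slot n j t -> K x -> c n x = j -> `|u x - u (X t)| <= e.
Proof.
move=> cu Hn j t x st Kx xj; apply/ler_addgt0Pr => d d0.
have /cvgrPdist_lt/(_ _ d0) := cu (X t).
move=> /(Xcl st)[y [[Ky yj] tyu]].
rewrite (_ : _ - _ = (u x - u y) - (u (X t) - u y)); last by ring.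
rewrite (le_trans (ler_normB _ _))// lerD//; last exact: ltW.
by apply: Hn => //; rewrite xj yj.
Qed.

Let D : set (measurableTypeR R) := `[0, mass[%classic.
Let mD : measurable D. Proof. exact: measurable_itv. Qed.

Lemma DP t : D t <-> 0 <= t < mass.
Proof. by rewrite /D /= in_itv. Qed.

(** Inside [0, Lambda 1) the preimage of an open set is a union of slots, of which
    there are countably many: a slot of sufficient depth around
    [t] is mapped into a small ball around [X t]. *)
Lemma X_measurable : measurable_fun [set: measurableTypeR R] (X : _ -> borel).
Proof.
apply: (measurability (@open T : set (set borel)) erefl) => _ [U oU <-]; rewrite setTI.
pose good n j := `[< [set t | slot n j t] `<=` X @^-1` U >].
have -> : X @^-1` U = (\bigcup_n \bigcup_j
    (if good n j then [set t | slot n j t] else set0)) `|`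
    (if `[< U x0 >] then ~` D else set0).
  apply/seteqP; split => [t Ut|t [[n _ [j _]]|]].
  - have [tM|tM] := boolP (0 <= t < mass); last first.
      right; rewrite ifT; first by move/DP; exact/negP.
      by apply/asboolP; rewrite -(Xout tM).
    left; have /nbhs_ballP[e /= e0 eU] : nbhs (X t) U.
      by apply: open_nbhs_nbhs; split.
    have [n Hn] := X_near e0; have [j _ sj] := slot_exists b HL n tM.
    exists n => //; exists j => //; rewrite ifT//.
    by apply/asboolP => t' st'; apply: eU; exact: Hn sj st'.
  - by rewrite /good; case: asboolP => [H|//]; exact: H.
  - case: asboolP => [Ux0 nD|//] /=; rewrite Xout//; apply/negP; exact/DP.
apply: measurableU.
  apply: bigcup_measurable => n _; apply: bigcup_measurable => j _.
  by case: ifP => _; [exact: measurable_slot|exact: measurable0].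
by case: ifP => _; [exact: measurableC|exact: measurable0].
Qed.

(** The image of Lebesgue measure on [0, Lambda 1) under [X]; the canonical
    structure is applied by name because it depends on a proof of
    measurability. *)
Definition riesz_measure : {measure set borel -> \bar R} :=
  measure_function_pushforward__canonical__measure_function_Measure
    (mrestr lam mD) X_measurable.

Lemma riesz_measureE (A : set borel) : riesz_measure A = lam (X @^-1` A `&` D).
Proof. by []. Qed.

Lemma mass_ge0 : 0 <= mass.
Proof. by apply: HL.2 => // ; exists 1 => x _; rewrite normr1. Qed.

Lemma lamD : lam D = mass%:E.
Proof.
rewrite lebesgue_measure_itv/= lte_fin; case: ltP => [_|m0].
  by rewrite oppr0 adde0.
by congr EFin; apply/eqP; rewrite eq_le mass_ge0.
Qed.

Lemma riesz_measure_fin (A : set borel) : measurable A -> (riesz_measure A < +oo)%E.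
Proof.
move=> mA; have mXA : measurable (X @^-1` A : set (measurableTypeR R)).
  by rewrite -[X in measurable X]setTI; exact: X_measurable.
apply: (@le_lt_trans _ _ (lam D)); last by rewrite lamD ltry.
by apply: le_measure; rewrite ?inE//; exact: measurableI.
Qed.

Lemma compact_borel (A : set T) : compact A -> measurable (A : set borel).
Proof.
move=> /(compact_closed hT) cA; rewrite -[A]setCK; apply: measurableC.
by apply: sub_sigma_algebra; exact: closed_openC.
Qed.

(** Away from end points, [t] is interior to its slots. *)
Lemma X_continuous t : D t -> (forall n j, t != cumul n j) -> {for t, continuous X}.
Proof.
move=> /DP tM tE U /nbhs_ballP[e /= e0 eU].
have [n Hn] := X_near e0; have [j _ sj] := slot_exists b HL n tM.
have tj : t \in `]cumul n j, cumul n j.+1[.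
  by move: (sj) => /andP[jt tj]; rewrite in_itv/= tj andbT lt_neqAle jt eq_sym tE.
apply: filterS (near_in_itvoo tj) => t'; rewrite in_itv /= => /andP[jt' tj'].
by apply/eU/(Hn _ _ _ sj)/andP; split => //; exact: ltW.
Qed.

(** Approximate the preimage of [B], stripped of the null set of end points, by a
    compact set [V]; as [X] is continuous there, [X @` V] is compact. *)
Lemma riesz_measure_regular (B : set borel) : measurable B ->
  riesz_measure B = ereal_sup [set riesz_measure A | A in
     [set A : set T | compact A /\ A `<=` B]].
Proof.
move=> mB; have mXB : measurable (X @^-1` B : set (measurableTypeR R)).
  by rewrite -[X in measurable X]setTI; exact: X_measurable.
apply/eqP; rewrite eq_le; apply/andP; split; last first.
  apply: ge_ereal_sup => _ /= [A [cA AB] <-].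
  by apply: (@le_measure _ _ _ riesz_measure); rewrite ?inE//; exact: compact_borel.
(* the end points of all slots *)
pose E : set (measurableTypeR R) := \bigcup_n range (cumul n).
have cE : countable E.
  apply: bigcup_countable => // n _.
  exact/(sub_countable (card_image_le _ _))/countableP.
have mE : measurable E by exact: countable_measurable.
pose A := (X @^-1` B `&` D) `\` E.
have mA : measurable A by apply: measurableD => //; exact: measurableI.
apply/lee_addgt0Pr => e e0.
have Afin : (lam A < +oo)%E.
  apply: (@le_lt_trans _ _ (lam D)); last by rewrite lamD ltry.
  by apply: le_measure; rewrite ?inE//; move=> t [[]].
have [V [cV VA Ve]] := lebesgue_regularity_inner mA Afin e0.
have mV : measurable (V : set (measurableTypeR R)).
  exact: compact_measurable.
have cXV : compact (X @` V).
  apply: continuous_compact cV; apply: continuous_in_subspaceT => t.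
  rewrite inE => /VA[[_ Dt] nE]; apply: X_continuous => // n j.
  by apply/eqP => tE; apply: nE; exists n => //; exists j.
have XVB : X @` V `<=` B by move=> _ [t /VA[[Bt _] _] <-].
apply: (@le_trans _ _ (riesz_measure (X @` V) + e%:E)%E); last first.
  by rewrite leeD2r//; apply: ereal_sup_ubound; exists (X @` V).
rewrite !riesz_measureE.
have mXV : measurable (X @^-1` (X @` V) : set (measurableTypeR R)).
  by rewrite -[X in measurable X]setTI; apply: X_measurable => //; exact: compact_borel.
apply: (@le_trans _ _ (lam (V `|` (A `\` V) `|` E))).
  apply: le_measure; rewrite ?inE//; first exact: measurableI.
    by apply: measurableU => //; apply: measurableU => //; exact: measurableD.
  move=> t XBt; have [Et|nEt] := pselect (E t); first by right.
  left; have [Vt|nVt] := pselect (V t); first by left.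
  by right; split.
rewrite measureU0//; last 2 first.
  by apply: measurableU => //; exact: measurableD.
  exact: countable_lebesgue_measure0.
rewrite measureU//; last 2 first.
  exact: measurableD.
  by rewrite setDE setICA setICr setI0.
apply: leeD; last exact: ltW.
apply: le_measure; rewrite ?inE//; first exact: measurableI.
by move=> t Vt; split; [exists t|exact: (VA _ Vt).1.2].
Qed.


Local Notation nu := (mrestr lam mD).

Lemma slot_sub_D n j : [set t | slot n j t] `<=` D.
Proof. by move=> t /(slot_bounds HL)/DP. Qed.

Lemma lam_slot n j : lam [set t | slot n j t] = (cumul n j.+1 - cumul n j)%:E.
Proof.
rewrite slotE lebesgue_measure_itv/= lte_fin; case: ltP => [//|ge].
congr EFin; apply/esym/eqP; rewrite subr_eq0 eq_le ge.
exact: (cumul_le b HL).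
Qed.

Lemma nu_slot n j :
  nu ([set t | slot n j t] `&` D) = (cumul n j.+1 - cumul n j)%:E.
Proof. by rewrite /mrestr !(setIidl (@slot_sub_D n j)) lam_slot. Qed.

Lemma nuD : nu D = mass%:E.
Proof. by rewrite /mrestr setIid lamD. Qed.

Lemma nuD_fin : (nu D < +oo)%E.
Proof. by rewrite nuD ltry. Qed.

(** The integral of a function constant on the slots, to be matched with
    [functional_step] below: slots and cells have equal masses. *)
Lemma integral_step n (a : nat -> R) N :
  let s t := \sum_(j < N) a j * \1_[set t | slot n j t] t in
  nu.-integrable D (EFin \o s) /\
  \int[nu]_(t in D) s t = \sum_(j < N) a j * (cumul n j.+1 - cumul n j).
Proof.
elim: N => [|N [IH1 IH2]] /=.
  under [X in _.-integrable _ (EFin \o X)]eq_fun do rewrite big_ord0.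
  under eq_Rintegral do rewrite big_ord0.
  rewrite big_ord0; split; first exact: integrable0.
  by rewrite Rintegral_cst// mul0r.
under [X in _.-integrable _ (EFin \o X)]eq_fun do rewrite big_ord_recr /=.
under eq_Rintegral do rewrite big_ord_recr /=.
have i1 : nu.-integrable D (EFin \o (\1_[set t | slot n N t] : R -> R)).
  apply: measurable_bounded_integrable => //; first exact: nuD_fin.
    by apply: measurable_indic; exact: measurable_slot.
  exists 1; split => // M M1 t _ /=.
  by rewrite indicE; case: (_ \in _); rewrite ?normr1 ?normr0 ltW// (lt_trans ltr01).
have i2 : nu.-integrable D (EFin \o (fun t => a N * \1_[set t | slot n N t] t)).
  by apply: (integrableZl mD (a N)) i1.
split; first exact: (integrableD mD IH1 i2).
rewrite RintegralD// RintegralZl// IH2 big_ord_recr /=; congr (_ + _ * _).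
rewrite /Rintegral integral_indic//; last exact: measurable_slot.
by have /(congr1 fine) := nu_slot n N.
Qed.

Lemma functional_step n (a : nat -> R) N : 
  let s (x : T) := \sum_(j < N) a j * (c n x == j)%:R in
  bounded_fun_on K s /\
  Lambda s = \sum_(j < N) a j * (cumul n j.+1 - cumul n j).
Proof.
elim: N => [|N [IH1 IH2]] /=.
  rewrite (_ : (fun _ => _) = 0); last by apply/funext => x; rewrite big_ord0.
  by split; [exists 0 => x _; rewrite normr0|rewrite big_ord0 (functional0 HL)].
have bN := @bounded_ind R T K (fun x => c n x == N).
rewrite (_ : (fun _ => _) =
    a N *: (fun x => (c n x == N)%:R) +
    (fun x => \sum_(j < N) a j * (c n x == j)%:R)); last first.
  by apply/funext => x; rewrite big_ord_recr addrC.
split.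
  have [M HM] := IH1; exists (`|a N| + M) => x Kx.
  rewrite (le_trans (ler_normD _ _))// lerD ?HM//.
  rewrite [X in `|X|](_ : _ = a N * (c n x == N)%:R)// normrM.
  by case: (_ == _); rewrite ?normr1 ?normr0 ?mulr1 ?mulr0.
by rewrite HL.1// IH2 big_ord_recr /= addrC (cumul_cell b HL).
Qed.

Lemma borel_measurable_continuous (u : T -> R) : continuous u ->
  measurable_fun [set: borel] (u : borel -> R).
Proof.
move=> /continuousP cu; apply: (measurability _ (RGenOpens.measurableE R)).
move=> _ [_ [p [q ->] <-]]; rewrite setTI; apply: sub_sigma_algebra.
by apply: cu; exact: interval_open.
Qed.

Lemma continuous_bounded_on_compact (u : T -> R) : continuous u -> bounded_fun_on K u.
Proof.
move=> cu; have /compact_bounded[M [Mr HM]] : compact (u @` K).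
  by apply: continuous_compact cK; exact: continuous_subspaceT.
by exists (M + 1) => x Kx; apply: HM; [rewrite ltrDl|exists x].
Qed.

(** Replacing [u] by its value at one chosen point of each cell changes the
    integral and the functional by at most [e * mass] each, and both then equal the same
    finite sum. *)
Lemma riesz_approx (u : T -> R) e : continuous u -> 0 < e ->
  nu.-integrable D (EFin \o (u \o X)) ->
  `|\int[nu]_(t in D) (u (X t)) - Lambda u| <= e * mass + e * mass.
Proof.
move=> cu e0 iu; have bu := continuous_bounded_on_compact cu.
have [n Hn] := uniform_on_cells cK small (fun x _ => cu x) e0.
(* [r j] is a point of cell [j], unless that cell is empty *)
have /choice[r Hr] (j : nat) : exists y, forall x, K x -> c n x = j -> K y /\ c n y = j.
  have [[x [Kx xj]]|nx] := pselect (exists x, K x /\ c n x = j); first by exists x.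
  by exists x0 => x Kx xj; exfalso; apply: nx; exists x.
pose a j := u (r j).
have [is_ Is] := integral_step n a (2 ^ n).
have [bs Ls] := functional_step n a (2 ^ n).
set I := \sum_(j < _) _ in Is Ls.
have b1 : bounded_fun_on K (fun=> 1 : R) by exists 1 => x _; rewrite normr1.
have ie k : nu.-integrable D (EFin \o (fun=> k : R)).
  apply: measurable_bounded_integrable => //; first exact: nuD_fin.
  by exists `|k|; split => // M' kM' t _; exact: ltW.
have Lshift k : Lambda (k *: (fun=> 1) +
    (fun x => \sum_(j < 2 ^ n) a j * (c n x == j)%:R)) = k * mass + I.
  by rewrite HL.1// Ls.
have bshift k : bounded_fun_on K (k *: (fun=> 1) +
    (fun x => \sum_(j < 2 ^ n) a j * (c n x == j)%:R)).
  have [M HM] := bs; exists (`|k| + M) => x Kx.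
  rewrite (le_trans (ler_normD _ _))// lerD ?HM//.
  by rewrite [X in `|X|](_ : _ = k * 1)// mulr1.
have sE x : K x -> \sum_(j < 2 ^ n) a j * (c n x == j)%:R = a (c n x).
  move=> Kx; rewrite (bigD1 (Ordinal (bitcode_lt b n x)))//= eqxx mulr1.
  rewrite big1 ?addr0// => j.
  by rewrite -val_eqE/= eq_sym => /negbTE ->; rewrite mulr0.
have ux x : K x -> `|u x - a (c n x)| <= e.
  by move=> Kx; have [Kr rE] := Hr _ _ Kx erefl; apply: Hn.
have L1 : `|Lambda u - I| <= e * mass.
  rewrite ler_norml; apply/andP; split.
    rewrite lerBrDr -mulNr -Lshift; apply: (functional_le HL) => // x Kx.
    rewrite [X in X <= _](_ : _ = (- e) * 1 + \sum_(j < 2 ^ n) a j * (c n x == j)%:R)//.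
    by rewrite sE//; have := ux _ Kx; rewrite ler_norml => /andP[]; lra.
  rewrite lerBlDr -Lshift; apply: (functional_le HL) => // x Kx.
  rewrite [X in _ <= X](_ : _ = e * 1 + \sum_(j < 2 ^ n) a j * (c n x == j)%:R)//.
  by rewrite sE//; have := ux _ Kx; rewrite ler_norml => /andP[]; lra.
have tE t : D t -> `|u (X t) - \sum_(j < 2 ^ n) a j * \1_[set t | slot n j t] t| <= e.
  move=> /DP tM; have [j jn sj] := slot_exists b HL n tM.
  rewrite (bigD1 (Ordinal jn))//= indicE mem_set// mulr1 big1 ?addr0; last first.
    move=> i ij; rewrite indicE memNset ?mulr0// => si; move/negP: ij; apply.
    by apply/eqP/val_inj; exact: (slot_uniq HL si sj).
  have [x Kx xj] := slot_cell HL sj.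
  have [Kr rE] := Hr _ _ Kx xj.
  by rewrite distrC; exact: (X_cell cu Hn sj).
have L2 : `|\int[nu]_(t in D) (u (X t)) - I| <= e * mass.
  have ce k : \int[nu]_(t in D) k = k * mass.
    by rewrite Rintegral_cst//; congr (_ * _); have /(congr1 fine) := nuD.
  rewrite ler_norml; apply/andP; split.
    rewrite lerBrDr -mulNr -ce -Is -RintegralD//.
    apply: le_Rintegral => //; first exact: (integrableD mD (ie _) is_).
    by move=> t /tE; rewrite ler_norml => /andP[]; lra.
  rewrite lerBlDr -ce -Is -RintegralD//.
  apply: le_Rintegral => //; first exact: (integrableD mD (ie _) is_).
  by move=> t /tE; rewrite ler_norml => /andP[]; lra.
rewrite (_ : _ - _ = (\int[nu]_(t in D) (u (X t)) - I) - (Lambda u - I)); last by ring.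
by rewrite (le_trans (ler_normB _ _))// lerD.
Qed.

Theorem integral_riesz_measure (u : T -> R) : continuous u ->
  riesz_measure.-integrable [set: borel] (EFin \o u) /\
  (Lambda u)%:E = (\int[riesz_measure]_x (u x)%:E)%E.
Proof.
move=> cu; have [M HM] := continuous_bounded_on_compact cu.
have mu_ := borel_measurable_continuous cu.
have muX : measurable_fun [set: measurableTypeR R] (u \o X).
  by apply: (@measurableT_comp _ _ _ _ borel _ u) => //; exact: X_measurable.
have bX A : [bounded (u \o X) x | x in A].
  exists M; split; first exact: num_real.
  by move=> M' MM' t _; apply: le_trans (ltW MM'); exact: HM.
have nuN : nu (~` D) = 0%E by rewrite /mrestr setICl measure0.
have nuT : (nu setT < +oo)%E by rewrite /mrestr setTI lamD ltry.
have iT : nu.-integrable setT (EFin \o (u \o X)).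
  exact: measurable_bounded_integrable.
have iD : nu.-integrable D (EFin \o (u \o X)).
  by apply: integrableS iT.
have iu : riesz_measure.-integrable setT (EFin \o u).
  apply: integrable_pushforward => //; first exact: X_measurable.
  exact/measurable_EFinP.
split => //.
rewrite [RHS](integral_pushforward X_measurable)//; last exact/measurable_EFinP.
rewrite [RHS](negligible_integral (measurableC mD) measurableT iT nuN).
rewrite setTD setCK.
rewrite -[RHS]fineK; last exact: integrable_fin_num.
congr EFin; apply/eqP; rewrite eq_sym -subr_eq0 -normr_le0.
apply/ler_addgt0Pr => d d0; rewrite add0r.
have e0 : 0 < d / (mass + mass + 1).
  by rewrite divr_gt0// ltr_wpDl// addr_ge0// mass_ge0.
apply: (le_trans (riesz_approx cu e0 iD)).
rewrite -mulrDr mulrAC ler_pdivrMr; last by rewrite ltr_wpDl// addr_ge0// mass_ge0.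
by rewrite ler_wpM2l ?ltW// ltrDl.
Qed.

End riesz.

(** The Riesz representation theorem for a compact set, with a functional given on all
    bounded functions. *)
Theorem riesz_on_compact (R : realType) (T : pseudoPMetricType R) (K : set T)
    (Lambda : (T -> R) -> R) :
  hausdorff_space T -> compact K -> K !=set0 -> positive_functional_on K Lambda ->
  exists mu : {measure set (g_sigma_algebraType (@open T)) -> \bar R},
    [/\ forall A, measurable A -> (mu A < +oo)%E,
        forall B, measurable B -> mu B = ereal_sup [set mu A | A in
          [set A : set T | compact A /\ A `<=` B]],
        mu (~` K) = 0%E &
        forall u : T -> R, continuous u ->
          mu.-integrable setT (EFin \o u) /\ (Lambda u)%:E = (\int[mu]_x (u x)%:E)%E].
Proof.
move=> hT cK [x0 Kx0] HL.
have [b small] := compact_small_cells_bits cK.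
have [X [KX Xout Xcl]] := quantile_exists b HL cK Kx0.
exists (riesz_measure HL small Xout Xcl); split.
- exact: riesz_measure_fin.
- exact: riesz_measure_regular.
- rewrite riesz_measureE (_ : X @^-1` (~` K) = set0) ?set0I ?measure0//.
  by apply/seteqP; split => // t; apply; exact: KX.
- by move=> u cu; exact: integral_riesz_measure.
Qed.

(** * Moment functionals *)

Section moments.
Variables (R : realType) (d : nat) (K : set 'rV[R]_d) (L : {scalar {mpoly R[d]}}).
Hypothesis cK : compact K.
Hypothesis Lnn : forall p, (forall x, K x -> 0 <= evalp p x) -> 0 <= L p.

Lemma evalp_bounded p : bounded_fun_on K (evalp p).
Proof.
exact: (@continuous_bounded_on_compact R ('rV[R]_d : normedModType R) K cK _
  (@evalp_continuous _ _ p)).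
Qed.

Lemma massless_functional_eq0 : L 1 = 0 -> forall p, L p = 0.
Proof.
(* as [L 1 = 0], adding a constant to [q] does not change [L q] *)
move=> L10 p; have [M HM] := evalp_bounded p.
have Lge0 (q : {mpoly R[d]}) : (forall x, K x -> `|evalp q x| <= M) -> 0 <= L q.
  move=> qM; have : 0 <= L (q + M *: 1).
    apply: Lnn => x Kx; rewrite evalpD evalpZ evalp1 mulr1.
    by have := qM _ Kx; rewrite ler_norml => /andP[]; lra.
  by rewrite linearD linearZ /= L10 mulr0 addr0.
apply/eqP; rewrite eq_le Lge0// andbT -oppr_ge0 -linearN Lge0// => x Kx.
by rewrite evalpN normrN HM.
Qed.

Lemma zero_moment_functional : (forall p, L p = 0) -> moment_functional K L.
Proof.
move=> L0; exists mzero; split => //.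
- split => [A _|B _]; first by rewrite /mzero ltry.
  apply/eqP; rewrite eq_le; apply/andP; split; last first.
    by apply: ge_ereal_sup => _ [A _ <-].
  by apply: ereal_sup_ubound; exists set0 => //; split => //; exact: compact0.
- move=> p; rewrite integral_measure_zero L0; split => //.
  apply/integrableP; split; last by rewrite integral_measure_zero ltry.
  apply/measurable_EFinP.
  exact: (@borel_measurable_continuous R ('rV[R]_d : normedModType R) _
    (@evalp_continuous _ _ p)).
Qed.

(** Haviland's theorem for compact sets. *)
Theorem haviland_compact : moment_functional K L.
Proof.
have [/massless_functional_eq0/zero_moment_functional//|L1n0] := eqVneq (L 1) 0.
have L1gt : 0 < L 1.
  by rewrite lt0r L1n0; apply: Lnn => x _; rewrite evalp1.
have K0 : K !=set0.
  apply: contrapT => K0; have : 0 <= L (-1).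
    by apply: Lnn => x Kx; exfalso; apply: K0; exists x.
  by rewrite linearN oppr_ge0 leNgt L1gt.
have hT : hausdorff_space 'rV[R]_d by exact: norm_hausdorff.
have [|||Lam [HLam LamE]] := @positive_extension R 'rV[R]_d K {mpoly R[d]}
  (@evalp R d) L 1 _ evalp_bounded _ L1gt.
- by move=> a u v x; rewrite evalpD evalpZ.
- by move=> x; rewrite evalp1.
- by move=> w w0; exact: Lnn.
have [mu [mufin mureg muK muint]] :=
  @riesz_on_compact R ('rV[R]_d : normedModType R) K Lam hT cK K0 HLam.
exists mu; split => //.
- split => // A cA; apply: mufin; rewrite -[A]setCK; apply: measurableC.
  by apply: sub_sigma_algebra; apply: closed_openC; exact: compact_closed.
- by move=> p; rewrite -LamE; exact: muint (@evalp_continuous _ _ p).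
Qed.
End moments.

Theorem theorem12p50 (R : realType) (d k r : nat)
    (f : 'I_k -> {mpoly R[d]}) (g : 'I_r.+1 -> {mpoly R[d]})
    (hk : (0 < k)%N) (hg0 : g ord0 = 1)
    (hf : archimedean_semiring (gen_semiring f)) :
  (forall h : {mpoly R[d]},
     (forall x : 'rV[R]_d,
        (nonneg_set f `&` nonneg_set g) x -> 0 < evalp h x) ->
     semiring_cone f g h) /\
  (forall L : {scalar {mpoly R[d]}},
     (forall p : {mpoly R[d]}, semiring_cone f g p -> 0 <= L p) ->
     compact (nonneg_set f `&` nonneg_set g) /\
     moment_functional (nonneg_set f `&` nonneg_set g) L).
Proof.
split => [h|L Lpos]; first exact: positivstellensatz.
have cK : compact (nonneg_set f `&` nonneg_set g).
  by apply: compact_closedI; [exact: archimedean_compact|exact: nonneg_set_closed].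
split => //; apply: haviland_compact => //.
exact: positive_on_nonneg_polys hg0 hf Lpos.
Qed.
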